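(* Let $\mathcal H$ be a complex Hilbert space with a dictionary $\mathcal A$, and let $\rho\in(0,1]$. For any $f\in\mathcal H$, with a sequence $a_1,\dots,a_n,\dots$ consecutively selected from $\mathcal A$ under the Pre-Orthogonal $\rho$-Maximal Selection Principle, we have $$f=\sum_{k=1}^\infty\langle f,B_k\rangle B_k$$ (convergence in $\mathcal H$), where for each $k$ the system $\{B_1,\dots,B_k\}$ is the result of the Gram-Schmidt orthonormalization process applied to $\{a_1,\dots,a_k\}$.
   Context: A dictionary of $\mathcal H$ is a subset $\mathcal A\subset\mathcal H$ with $\|a\|=1$ for all $a\in\mathcal A$ and $\overline{\mathrm{span}}\,\mathcal A=\mathcal H$. Given selected $a_1,\dots,a_{k-1}\in\mathcal A$ with Gram-Schmidt orthonormalization $\{B_1,\dots,B_{k-1}\}$, the orthogonal standard remainder is $g_k=f-\sum_{i=1}^{k-1}\langle f,B_i\rangle B_i$ (so $g_1=f$). For $a\in\mathcal A$ not in $\mathrm{span}\{a_1,\dots,a_{k-1}\}$, let $B_k^a$ be the element such that $\{B_1,\dots,B_{k-1},B_k^a\}$ is the Gram-Schmidt orthonormalization of $\{a_1,\dots,a_{k-1},a\}$. The sequence is selected under the Pre-Orthogonal $\rho$-Maximal Selection Principle if for each $k$ the element $a_k\in\mathcal A$ (not in $\mathrm{span}\{a_1,\dots,a_{k-1}\}$), with $B_k=B_k^{a_k}$, satisfies $$|\langle g_k,B_k\rangle|\ge\rho\,\sup\{|\langle g_k,B_k^a\rangle|\ :\ a\in\mathcal A\},$$ where the supremum is over those $a\in\mathcal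 A$ for which $B_k^a$ is defined. *)

(* Defs.v *)
From HB Require Import structures.
From mathcomp Require Import all_boot all_order all_algebra.
From mathcomp Require Import complex.
From mathcomp Require Import all_classical all_reals.
From mathcomp Require Import topology normedtype sequences.

Set Implicit Arguments.
Unset Strict Implicit.
Unset Printing Implicit Defensive.

Import Order.TTheory GRing.Theory Num.Theory.
Import numFieldNormedType.Exports.

Local Open Scope classical_set_scope.
Local Open Scope ring_scope.

(* The vectors a_1, a_2, ... are indexed from 0: [a k] stands for a_(k+1), and
   [mkseq a k] lists the k vectors that precede it.  [dot] is linear in its
   first argument and conjugate-linear in the second. *)

Section Defs.
Variables (R : realType) (H : completeNormedModType R[i]).
Variable dot : {dot H for Num.conj}.

Definition lspan (X : set H) : set H :=
  [set x | exists n (c : 'I_n -> R[i]) (v : 'I_n -> H),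
     (forall i, X (v i)) /\ x = \sum_(i < n) c i *: v i].

Definition dictionary (A : set H) : Prop :=
  (forall a, A a -> `|a| = 1) /\ closure (lspan A) = setT.

Definition gs_residual (s : seq H) (x : H) : H :=
  x - \sum_(b <- s) dot x b *: b.

Definition gram_schmidt (s : seq H) : seq H :=
  foldl (fun t x => rcons t (`|gs_residual t x|^-1 *: gs_residual t x)) [::] s.

(* B_(k+1)^x; meaningful when x is not in the span of a 0, ..., a (k-1). *)
Definition pre_orth (a : nat -> H) (k : nat) (x : H) : H :=
  last 0 (gram_schmidt (rcons (mkseq a k) x)).

Definition gs_basis (a : nat -> H) (k : nat) : H := pre_orth a k (a k).

Definition std_remainder (f : H) (a : nat -> H) (k : nat) : H :=
  f - \sum_(i < k) dot f (gs_basis a i) *: gs_basis a i.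

Definition admissible (A : set H) (a : nat -> H) (k : nat) : set H :=
  A `\` lspan (a @` `I_k).

(* The supremum is a genuine one: the set contains the value at [a k] and, by
   Cauchy-Schwarz, is bounded by the norm of the remainder.  [Normc.normc] is
   the modulus of a complex number, as an element of R. *)
Definition pre_orth_maximal_selection (A : set H) (rho : R) (f : H)
    (a : nat -> H) : Prop :=
  forall k, admissible A a k (a k) /\
    Normc.normc (dot (std_remainder f a k) (gs_basis a k)) >=
      rho * sup [set Normc.normc (dot (std_remainder f a k) (pre_orth a k x))
                | x in admissible A a k].

Lemma gram_schmidt_rcons s x :
  gram_schmidt (rcons s x) =
  rcons (gram_schmidt s) (`|gs_residual (gram_schmidt s) x|^-1
                            *: gs_residual (gram_schmidt s) x).
Proof. by rewrite /gram_schmidt -cats1 foldl_cat. Qed.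

Lemma gram_schmidt_mkseq a n :
  gram_schmidt (mkseq a n) = mkseq (gs_basis a) n.
Proof.
elim: n => [//|n IHn].
by rewrite !mkseqS gram_schmidt_rcons {1}IHn /gs_basis /pre_orth
  gram_schmidt_rcons last_rcons IHn.
Qed.

End Defs.

(* Main.v *)
Require Import Defs.
From HB Require Import structures.
From mathcomp Require Import all_boot all_order all_algebra.
From mathcomp Require Import complex.
From mathcomp Require Import all_classical all_reals.
From mathcomp Require Import topology normedtype sequences.

Import Order.TTheory GRing.Theory Num.Theory.
Import numFieldNormedType.Exports.

Local Open Scope classical_set_scope.
Local Open Scope ring_scope.

(** Let r_k be the remainder of f after k steps.  It is orthogonal to every
    B_i with i < k, so for m <= n the increment r_m - r_n, which lies in
    span (B_m, ..., B_(n-1)), is orthogonal to r_n, and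
      |r_m|^2 = |r_n|^2 + |r_m - r_n|^2  ([std_remainder_pythagoras]).
    Hence |r_k|^2 decreases, r_k is a Cauchy sequence and has a limit g
    ([std_remainder_cvg]); what remains is to show g = 0, which follows once g
    is orthogonal to the dictionary ([dictionary_orth]).

    The selection principle gives this orthogonality.  For x in A outside the
    span of the first k atoms, the normalized remainder B_k^x of x satisfies
    <r_k, x> = |x_k| <r_k, B_k^x>, where x_k is the remainder of x after k
    steps and |x_k| <= |x| = 1, so
      rho |<r_k, x>| <= rho |<r_k, B_k^x>| <= |<r_k, B_k>|;
    for x inside that span <r_k, x> = 0 and the same bound holds
    ([selection_bound]).  Finally |<r_k, B_k>| = |r_k - r_(k+1)|, which tends
    to 0, so <g, x> = 0.

    The Gram-Schmidt vectors are handled through the single identity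
    |B_k| = (B_k != 0): a normalized vector has norm 1 or is null, and in both
    cases <u, v> v is the orthogonal projection of u on the line of v. *)

Set Implicit Arguments.
Unset Strict Implicit.

(** * Geometry of the inner product *)

Section InnerProduct.
Variables (R : realType) (H : completeNormedModType R[i]).
Variable dot : {dot H for Num.conj}.
Hypothesis dot_norm : forall x : H, dot x x = `|x| ^+ 2.

Lemma dotZl c u v : dot (c *: u) v = c * dot u v.
Proof. by rewrite linearZl_LR. Qed.

Lemma dotZr c u v : dot u (c *: v) = c^* * dot u v.
Proof. by rewrite linearZr_LR. Qed.

Lemma dotBl u v w : dot (u - v) w = dot u w - dot v w.
Proof. exact: linearBl. Qed.

Lemma dotBr u v w : dot u (v - w) = dot u v - dot u w.
Proof. exact: linearBr. Qed.

Lemma dot_suml n (F : 'I_n -> H) w : dot (\sum_i F i) w = \sum_i dot (F i) w.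
Proof. exact: linear_sumlz. Qed.

Lemma dot_sumr n (F : 'I_n -> H) w : dot w (\sum_i F i) = \sum_i dot w (F i).
Proof. exact: linear_sumr. Qed.

Lemma dot_eq0C u v : dot u v = 0 -> dot v u = 0.
Proof.
have -> : dot v u = (dot u v)^* by rewrite hermC /= expr0 mul1r.
by move=> ->; rewrite conjC0.
Qed.

Lemma pythagoras u v : dot u v = 0 -> `|u + v| ^+ 2 = `|u| ^+ 2 + `|v| ^+ 2.
Proof. by move=> uv0; rewrite -!dot_norm hnormDd. Qed.

(** Covers unit and null vectors at once; a null [v] makes both sides vanish. *)
Lemma dot_unit_or_null u v : `|v| = (v != 0)%:R -> dot u v * dot v v = dot u v.
Proof.
rewrite dot_norm => ->; have [->|_] := eqVneq v 0.
  by rewrite linear0r mul0r.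
by rewrite expr1n mulr1.
Qed.

Lemma dot_sub_proj u v : `|v| = (v != 0)%:R -> dot (u - dot u v *: v) v = 0.
Proof. by move=> v1; rewrite dotBl dotZl dot_unit_or_null// subrr. Qed.

(** The inverse of 0 being 0, normalizing the null vector returns it. *)
Lemma norm_normalize (x : H) :
  `| `|x|^-1 *: x | = (`|x|^-1 *: x != 0)%:R.
Proof.
have [->|x0] := eqVneq x 0; first by rewrite scaler0 normr0 eqxx.
rewrite normrZ normfV normr_id mulVf ?normr_eq0//.
by rewrite scaler_eq0 invr_eq0 normr_eq0 orbb x0.
Qed.

Lemma normalizeK (x : H) : `|x| *: (`|x|^-1 *: x) = x.
Proof.
have [->|x0] := eqVneq x 0; first by rewrite !scaler0.
by rewrite scalerA mulfV ?scale1r ?normr_eq0.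
Qed.

(** With w the normalization of v, the vector u splits orthogonally as
    (u - <u, w> w) + <u, w> w, so |<u, w>| <= |u|; scaling w back to v gives
    the inequality. *)
Lemma cauchy_schwarz u v : `|dot u v| <= `|u| * `|v|.
Proof.
set w := `|v|^-1 *: v; have w1 : `|w| = (w != 0)%:R by exact: norm_normalize.
have uw : `|dot u w| <= `|u|.
  rewrite -(@ler_pXn2r _ 2)// ?nnegrE ?normr_ge0//.
  rewrite -[X in _ <= `|X| ^+ 2](subrK (dot u w *: w)) pythagoras; last first.
    by rewrite dotZr dot_sub_proj// mulr0.
  have -> : `|dot u w *: w| = `|dot u w|.
    rewrite normrZ w1; case: eqVneq => [->|_]; rewrite ?mulr1//.
    by rewrite linear0r normr0 mul0r.
  by rewrite lerDr exprn_ge0.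
rewrite -{1}(normalizeK v) -/w dotZr normrM norm_conjC normr_id mulrC.
by rewrite ler_wpM2r.
Qed.

End InnerProduct.

(** * Remainders along the Gram-Schmidt system *)

Section GramSchmidt.
Variables (R : realType) (H : completeNormedModType R[i]).
Variable dot : {dot H for Num.conj}.
Hypothesis dot_norm : forall x : H, dot x x = `|x| ^+ 2.
Variable a : nat -> H.

Local Notation B := (gs_basis dot a).
Local Notation rem x k := (std_remainder dot x a k).

Lemma gs_residual_mkseq x k : gs_residual dot (mkseq B k) x = rem x k.
Proof.
rewrite /gs_residual /std_remainder /mkseq big_map.
by rewrite -(big_mkord xpredT (fun i => dot x (B i) *: B i)) /index_iota subn0.
Qed.

(** Recasts the list-based process as normalization of the remainder of [x]
    itself, so that the properties of remainders of arbitrary vectors apply to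
    the Gram-Schmidt vectors. *)
Lemma pre_orthE k x : pre_orth dot a k x = `|rem x k|^-1 *: rem x k.
Proof.
rewrite /pre_orth gram_schmidt_rcons last_rcons gram_schmidt_mkseq.
by rewrite gs_residual_mkseq.
Qed.

Lemma std_remainderS x k : rem x k.+1 = rem x k - dot x (B k) *: B k.
Proof. by rewrite /std_remainder big_ord_recr /= opprD addrA. Qed.

Lemma std_remainder0 x : rem x 0%N = x.
Proof. by rewrite /std_remainder big_ord0 subr0. Qed.

Lemma norm_gs_basis k : `|B k| = (B k != 0)%:R.
Proof. by rewrite /gs_basis pre_orthE norm_normalize. Qed.

(** Induction on [k], simultaneously for all [x]: the vector B_k is itself
    a normalized remainder, so the induction hypothesis at [x := a k] makes it
    orthogonal to the preceding B_i, and subtracting its component from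
    [std_remainder dot x a k] keeps the orthogonality already obtained. *)
Lemma std_remainder_orth k : forall x i, (i < k)%N -> dot (rem x k) (B i) = 0.
Proof.
elim: k => [//|k IH] x i.
have Bk_orth j : (j < k)%N -> dot (B k) (B j) = 0.
  by move=> jk; rewrite {1}/gs_basis pre_orthE dotZl IH ?mulr0.
rewrite ltnS leq_eqVlt => /predU1P[->|ik]; rewrite std_remainderS dotBl dotZl.
  have -> : dot (rem x k) (B k) = dot x (B k).
    rewrite dotBl dot_suml big1 ?subr0// => j _.
    by rewrite dotZl (dot_eq0C (Bk_orth j (ltn_ord j))) mulr0.
  by rewrite dot_unit_or_null ?subrr// norm_gs_basis.
by rewrite IH// Bk_orth// mulr0 subrr.
Qed.

(** What is removed from [x] by stage [m] lies in the span of vectors that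
    the remainder of [f] at stage [n] is orthogonal to. *)
Lemma dot_std_remainder_le f x m n : (m <= n)%N ->
  dot (rem f n) (rem x m) = dot (rem f n) x.
Proof.
move=> mn; rewrite dotBr dot_sumr big1 ?subr0// => i _.
by rewrite dotZr std_remainder_orth ?mulr0// (leq_trans _ mn).
Qed.

(** Both [std_remainder dot f a m] and [std_remainder dot f a n] have the
    same product with the latter, so the latter is orthogonal to their
    difference. *)
Lemma std_remainder_pythagoras f m n : (m <= n)%N ->
  `|rem f m| ^+ 2 = `|rem f n| ^+ 2 + `|rem f m - rem f n| ^+ 2.
Proof.
move=> mn; rewrite -(pythagoras dot_norm) 1?[rem f n + _]addrC ?subrK//.
by rewrite dotBr !dot_std_remainder_le// subrr.
Qed.

Lemma norm_std_remainder_le f n : `|rem f n| <= `|f|.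
Proof.
rewrite -(@ler_pXn2r _ 2)// ?nnegrE ?normr_ge0//.
rewrite -[in leRHS](std_remainder0 f) (std_remainder_pythagoras f (leq0n n)).
by rewrite lerDl exprn_ge0.
Qed.

(** The product with [a j], for j < k, is the product with the remainder of
    [a j] at stage [j], which is a multiple of B_j. *)
Lemma dot_std_remainder_lspan f k x :
  lspan (a @` `I_k) x -> dot (rem f k) x = 0.
Proof.
move=> [n [c [v [va ->]]]]; rewrite dot_sumr big1// => i _.
rewrite dotZr; have [j /= jk <-] := va i.
rewrite -(dot_std_remainder_le _ _ (ltnW jk)) -(normalizeK (rem (a j) j)).
by rewrite -pre_orthE dotZr std_remainder_orth ?mulr0.
Qed.

(** Links the quantity controlled by the selection principle to the
    convergence of the remainders. *)
Lemma norm_std_remainder_step f k :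
  `|rem f k - rem f k.+1| = `|dot (rem f k) (B k)|.
Proof.
have BB j : (j < k)%N -> dot (B j) (B k) = 0.
  move=> jk; apply: dot_eq0C.
  by rewrite {1}/gs_basis pre_orthE dotZl std_remainder_orth ?mulr0.
have -> : dot (rem f k) (B k) = dot f (B k).
  by rewrite dotBl dot_suml big1 ?subr0// => j _; rewrite dotZl BB ?mulr0.
rewrite std_remainderS opprB addrC subrK normrZ norm_gs_basis.
by case: eqVneq => [->|_]; rewrite ?mulr1// linear0r normr0 mul0r.
Qed.

(** The squared norms decrease, so they converge in [R], and by Pythagoras
    their differences are the squared distances between remainders. *)
Lemma std_remainder_cvg f : cvg (rem f k @[k --> \oo]).
Proof.
(* The norm takes its values in [R[i]]; [e] is real-valued, as monotone
   convergence requires. *)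
pose e n : R := complex.Re (`|rem f n| ^+ 2).
have eE n : (e n)%:C%C = `|rem f n| ^+ 2.
  by rewrite RRe_real// ger0_real// exprn_ge0.
have e_ge0 n : 0 <= e n by rewrite -lecR eE exprn_ge0.
have e_noninc : {homo e : n m / (n <= m)%N >-> m <= n}.
  move=> m n mn; rewrite -lecR !eE (std_remainder_pythagoras f mn).
  by rewrite lerDl exprn_ge0.
have e_cvg : e n @[n --> \oo] --> inf (range e).
  by apply: nonincreasing_cvgn => //; exists 0 => _ [n _ <-].
have inf_le n : inf (range e) <= e n.
  by apply: ge_inf; [exists 0 => _ [m _ <-]|exists n].
apply/cauchy_cvgP/cauchyP => eps eps_gt0.
have [d d_gt0 dE] : exists2 d : R, 0 < d & d%:C%C = eps ^+ 2.
  have eps2 : 0 < eps ^+ 2 by rewrite exprn_gt0.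
  have dE : (complex.Re (eps ^+ 2))%:C%C = eps ^+ 2.
    by rewrite RRe_real// gtr0_real.
  by exists (complex.Re (eps ^+ 2)) => //; rewrite -ltcR dE.
have [N _ HN] : \forall n \near \oo, `|inf (range e) - e n| < d.
  by move/cvgrPdist_lt : e_cvg; apply.
exists (rem f N); exists N => // n /= Nn; rewrite -ball_normE /=.
rewrite -(@ltr_pXn2r _ 2)// ?nnegrE ?normr_ge0 ?(ltW eps_gt0)//.
have -> : `|rem f N - rem f n| ^+ 2 = (e N - e n)%:C%C.
  rewrite rmorphB /= !eE (std_remainder_pythagoras f Nn).
  by rewrite [RHS]addrC addKr.
rewrite -dE ltcR; apply: le_lt_trans (HN N (leqnn N)).
by rewrite distrC; apply: le_trans (ler_norm _); rewrite lerB.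
Qed.

End GramSchmidt.

(** * Consequences of the selection principle *)

Section Selection.
Variables (R : realType) (H : completeNormedModType R[i]).
Variable dot : {dot H for Num.conj}.
Hypothesis dot_norm : forall x : H, dot x x = `|x| ^+ 2.

(** A vector y of the span at distance less than |g| from g would give
    |g|^2 = <g, g - y> <= |g| |g - y| < |g|^2 by Cauchy-Schwarz. *)
Lemma dictionary_orth (A : set H) g : dictionary A ->
  (forall x, A x -> dot g x = 0) -> g = 0.
Proof.
move=> [_ A_dense] gA; apply/eqP; case: (eqVneq g 0) => // g0.
have ng : 0 < `|g| by rewrite normr_gt0.
have : closure (lspan A) g by rewrite A_dense.
move=> /(_ _ (nbhsx_ballx g _ ng)) [y [[n [c [v [vA yE]]]]]].
rewrite -ball_normE /= => gy.
have gy0 : dot g y = 0.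
  by rewrite yE dot_sumr big1// => i _; rewrite dotZr gA ?mulr0.
have := cauchy_schwarz dot_norm g (g - y).
rewrite dotBr gy0 subr0 dot_norm normrX normr_id expr2.
by rewrite ler_pM2l// => /le_lt_trans-/(_ _ gy); rewrite ltxx.
Qed.

Variables (A : set H) (rho : R) (f : H) (a : nat -> H).
Hypotheses (A_dict : dictionary A) (rho_gt0 : 0 < rho).
Hypothesis a_sel : pre_orth_maximal_selection dot A rho f a.

Local Notation B := (gs_basis dot a).
Local Notation rem x k := (std_remainder dot x a k).

(** For [x] in the span of the earlier atoms the left side is 0.  Otherwise
    [x] competes in the supremum, and passing from [x] to its normalized
    remainder can only increase the product, since |x| = 1. *)
Lemma selection_bound x k : A x ->
  rho%:C%C * `|dot (rem f k) x| <= `|dot (rem f k) (B k)|.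
Proof.
move=> Ax.
have [xspan|xspan] := pselect (lspan (a @` `I_k) x).
  by rewrite (dot_std_remainder_lspan dot_norm)// normr0 mulr0.
have [_ sel] := a_sel k.
set S := [set _ | _ in _] in sel.
have normcE z : (Normc.normc z)%:C%C = `|z| by [].
have Sx : S (Normc.normc (dot (rem f k) (pre_orth dot a k x))) by exists x.
(* Without an upper bound [sup S] would be a default value. *)
have ubS : has_ubound S.
  exists (complex.Re `|rem f k|) => _ [y [Ay _] <-].
  rewrite -lecR RRe_real ?normr_real// normcE.
  apply: (le_trans (cauchy_schwarz dot_norm _ _)).
  rewrite pre_orthE norm_normalize.
  by case: eqVneq => _ /=; rewrite ?mulr1 ?mulr0.
have le1 : rho * Normc.normc (dot (rem f k) (pre_orth dot a k x))
   <= Normc.normc (dot (rem f k) (B k)).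
  by apply: le_trans sel; rewrite ler_pM2l//; apply: ub_le_sup.
move: le1; rewrite -lecR rmorphM /= !normcE; apply: le_trans.
rewrite ler_pM2l ?ltcR//.
rewrite -(dot_std_remainder_le dot_norm a f x (leqnn k)).
rewrite -(normalizeK (rem x k)) -pre_orthE dotZr normrM norm_conjC normr_id ler_piMl//.
by apply: le_trans (norm_std_remainder_le dot_norm _ _ _) _; rewrite A_dict.1.
Qed.

(** If <g, x> were not 0 for the limit g and some x in A, choosing eps with
    (rho + 2) eps = rho |<g, x>| and N with r_N and r_(N+1) both within eps of
    g would give
      rho |<g, x>| <= rho |g - r_N| + |r_N - r_(N+1)| < (rho + 2) eps. *)
Lemma std_remainder_cvg0 : rem f k @[k --> \oo] --> 0.
Proof.
have /cvg_ex[/= g rem_cvg] : cvg (rem f k @[k --> \oo]).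
  exact: std_remainder_cvg.
suff <- : g = 0 by exact: rem_cvg.
apply: (dictionary_orth A_dict) => x Ax; apply/eqP/negPn/negP => gx0.
have rem_cvgS : rem f k.+1 @[k --> \oo] --> g by rewrite cvg_shiftS.
have rho_gt0C : 0 < rho%:C%C by rewrite ltcR.
pose eps := rho%:C%C * `|dot g x| / (rho%:C%C + 2).
have rho2 : 0 < rho%:C%C + 2 by rewrite addr_gt0.
have eps_gt0 : 0 < eps by rewrite divr_gt0// mulr_gt0// normr_gt0.
have [N [gN gN1]] : exists N, `|g - rem f N| < eps /\ `|g - rem f N.+1| < eps.
  apply: (@filter_ex _ \oo); apply: filterI.
    by move/cvgrPdist_lt : rem_cvg; apply.
  by move/cvgrPdist_lt : rem_cvgS; apply.
have lt_v : rho%:C%C * `|g - rem f N| + `|rem f N - rem f N.+1| <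
    rho%:C%C * `|dot g x|.
  rewrite -[ltRHS](divfK (lt0r_neq0 rho2)) -/eps mulrDr ltrD//.
    by rewrite [eps * _]mulrC ltr_pM2l.
  by rewrite (le_lt_trans (ler_distD g _ _))// mulr_natr mulr2n ltrD// distrC.
suff le_v : rho%:C%C * `|dot g x| <=
    rho%:C%C * `|g - rem f N| + `|rem f N - rem f N.+1|.
  by move: (le_lt_trans le_v lt_v); rewrite ltxx.
rewrite (norm_std_remainder_step dot_norm).
apply: le_trans (lerD (lexx _) (selection_bound N Ax)).
rewrite -mulrDr ler_pM2l//.
rewrite -[dot g x](subrK (dot (rem f N) x)) -dotBl.
apply: le_trans (ler_normD _ _) _; rewrite lerD2r.
apply: le_trans (cauchy_schwarz dot_norm _ _) _.
by rewrite (A_dict.1 _ Ax) mulr1.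
Qed.

End Selection.

Theorem theorem3p2 (R : realType) (H : completeNormedModType R[i])
    (dot : {dot H for Num.conj})
    (dot_norm : forall x : H, dot x x = `|x| ^+ 2)
    (A : set H) (A_dict : dictionary A)
    (rho : R) (rho_gt0 : 0 < rho) (rho_le1 : rho <= 1)
    (f : H) (a : nat -> H)
    (a_sel : pre_orth_maximal_selection dot A rho f a) :
  series (fun k => dot f (gs_basis dot a k) *: gs_basis dot a k) @ \oo --> f.
Proof.
rewrite (_ : series _ = fun k => f - std_remainder dot f a k); last first.
  apply/funext => k.
  by rewrite /series /= big_mkord /std_remainder opprB addrC subrK.
rewrite -[X in _ --> X]subr0; apply: cvgB; first exact: cvg_cst.
exact: std_remainder_cvg0 A_dict rho_gt0 a_sel.
Qed.
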